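(* Let $f=\frac1n\sum_{i=1}^n f_i:\mathbb{R}^d\to\mathbb{R}$ where each $f_i$ is (possibly nonconvex and) $L$-smooth, and let $x^*$ be an optimal solution (global minimizer) of $\min_{x\in\mathbb{R}^d} f(x)$. If $f$ is $\tau$-gradient dominated, then with $\eta=1/(3Ln^{2/3})$ and $T=\lceil 24L\tau n^{2/3}\rceil$, the iterates $x^k$ of the algorithm GD-SAGA$(x^0,K,T,\eta)$ satisfy $$\mathbb{E}[f(x^k)-f(x^* )]\le 2^{-k}[f(x^0)-f(x^* )].$$
   Context: A differentiable function $h$ is $L$-smooth ($L>0$) if $\|\nabla h(x)-\nabla h(y)\|\le L\|x-y\|$ for all $x,y\in\mathbb{R}^d$. For $\tau>0$, $f$ is $\tau$-gradient dominated if $f(x)-f(x^* )\le\tau\|\nabla f(x)\|^2$ for all $x\in\mathbb{R}^d$, where $x^*$ is a global minimizer of $f$. Write $[n]=\{1,\dots,n\}$. Algorithm SAGA$(x^0,T,\eta)$, with $x^0\in\mathbb{R}^d$, an integer $T\ge 1$ and step size $\eta>0$: set $\alpha_i^0=x^0$ for all $i\in[n]$ and $g^0=\frac1n\sum_{i=1}^n\nabla f_i(\alpha_i^0)$. For $t=0,\dots,T-1$: pick $i_t,j_t$ uniformly at random from $[n]$ (independently of each other and of the past); set $v^t=\nabla f_{i_t}(x^t)-\nabla f_{i_t}(\alpha_{i_t}^t)+g^t$; set $x^{t+1}=x^t-\eta v^t$; set $\alpha_{j_t}^{t+1}=x^t$ and $\alpha_j^{t+1}=\alpha_j^t$ for $j\ne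 j_t$; set $g^{t+1}=g^t-\frac1n(\nabla f_{j_t}(\alpha_{j_t}^t)-\nabla f_{j_t}(\alpha_{j_t}^{t+1}))$. Output a point chosen uniformly at random from $\{x^t\}_{t=0}^{T-1}$. Algorithm GD-SAGA$(x^0,K,T,\eta)$: starting from $x^0\in\mathbb{R}^d$, for $k=1,\dots,K$ let $x^k$ be the output of SAGA$(x^{k-1},T,\eta)$, run with fresh independent randomness. Output $x^K$. Expectations are over all the randomness. *)

(* Defs.v *)
From mathcomp Require Export all_boot all_order all_algebra.
From mathcomp Require Export all_classical all_reals all_analysis.
Export Order.TTheory GRing.Theory Num.Theory.
Export numFieldNormedType.Exports.

Set Implicit Arguments.
Unset Strict Implicit.
Unset Printing Implicit Defensive.

Local Open Scope ring_scope.

(* The library norm on 'rV[R]_d is the sup norm, hence a separate definition of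
   the Euclidean one. Differentiability is the same for both. *)
Definition norm2 (R : realType) (d : nat) (v : 'rV[R]_d) : R :=
  Num.sqrt (\sum_(j < d) v 0 j ^+ 2).

Definition grad (R : realType) (d : nat) (h : 'rV[R]_d -> R) (x : 'rV[R]_d) :
    'rV[R]_d :=
  \row_(j < d) 'D_(delta_mx 0 j) h x.

Definition smooth (R : realType) (d : nat) (L : R) (h : 'rV[R]_d -> R) : Prop :=
  (forall x, differentiable h x) /\
  (forall x y, norm2 (grad h x - grad h y) <= L * norm2 (x - y)).

Definition global_minimizer (R : realType) (d : nat) (f : 'rV[R]_d -> R)
    (xs : 'rV[R]_d) : Prop :=
  forall x, f xs <= f x.

(* [xs] is meant to be a global minimizer of [f]. *)
Definition gradient_dominated (R : realType) (d : nat) (tau : R)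
    (f : 'rV[R]_d -> R) (xs : 'rV[R]_d) : Prop :=
  forall x, f x - f xs <= tau * norm2 (grad f x) ^+ 2.

Definition finite_sum (R : realType) (d n : nat) (fs : 'I_n -> 'rV[R]_d -> R)
    (x : 'rV[R]_d) : R :=
  n%:R^-1 * \sum_(i < n) fs i x.

Record saga_state (R : realType) (d n : nat) := SagaState {
  saga_x : 'rV[R]_d;
  saga_alpha : 'I_n -> 'rV[R]_d;
  saga_g : 'rV[R]_d }.

Definition saga_init (R : realType) (d n : nat) (fs : 'I_n -> 'rV[R]_d -> R)
    (x0 : 'rV[R]_d) : saga_state R d n :=
  SagaState x0 (fun=> x0) (n%:R^-1 *: \sum_(i < n) grad (fs i) x0).

(* One iteration, for the sampled pair ij = (i_t, j_t). *)
Definition saga_step (R : realType) (d n : nat) (fs : 'I_n -> 'rV[R]_d -> R)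
    (eta : R) (s : saga_state R d n) (ij : 'I_n * 'I_n) : saga_state R d n :=
  let: SagaState x alpha g := s in
  let: (i, j) := ij in
  let v := grad (fs i) x - grad (fs i) (alpha i) + g in
  let alpha' := fun l => if l == j then x else alpha l in
  SagaState (x - eta *: v) alpha'
    (g - n%:R^-1 *: (grad (fs j) (alpha j) - grad (fs j) (alpha' j))).

Definition saga_run (R : realType) (d n : nat) (fs : 'I_n -> 'rV[R]_d -> R)
    (eta : R) (x0 : 'rV[R]_d) (ijs : seq ('I_n * 'I_n)) : saga_state R d n :=
  foldl (saga_step fs eta) (saga_init fs x0) ijs.

(* All the random choices of one SAGA call: the pairs (i_t, j_t) for t < T, and
   the index of the returned iterate. *)
Definition saga_sample (n T : nat) : finType :=
  (T.-tuple ('I_n * 'I_n) * 'I_T)%type.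

Definition saga (R : realType) (d n T : nat) (fs : 'I_n -> 'rV[R]_d -> R)
    (eta : R) (x0 : 'rV[R]_d) (w : saga_sample n T) : 'rV[R]_d :=
  saga_x (saga_run fs eta x0 (take w.2 w.1)).

Definition gd_saga_sample (n T K : nat) : finType := K.-tuple (saga_sample n T).

(* The iterate x^k: it uses the first k of the K independent SAGA samples. *)
Definition gd_saga (R : realType) (d n T K : nat) (fs : 'I_n -> 'rV[R]_d -> R)
    (eta : R) (x0 : 'rV[R]_d) (w : gd_saga_sample n T K) (k : nat) :
    'rV[R]_d :=
  foldl (saga fs eta) x0 (take k w).

(* Expectation under the uniform law on a nonempty finite type. On a product
   type this is the law of independent uniform coordinates. *)
Definition expect (R : realType) (Omega : finType) (F : Omega -> R) : R :=
  #|Omega|%:R^-1 * \sum_(w : Omega) F w.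

(* Main.v *)
(* Fix p = n^(-1/3), so that eta = p^2 / (3 L). Within one SAGA call the
   potential f(x) + (L p / 10) * (1/n) sum_l |x - alpha_l|^2 drops in expectation
   by at least (eta / 4) |grad f(x)|^2 at each step: smoothness bounds f after the
   step, the variance of the search direction is at most L^2 times the mean of
   the |x - alpha_l|^2, and the refreshed alpha_j contracts that mean by a factor
   1 - 1/n. A weight independent of t suffices, because the usual backward
   recursion for the weights has a fixed point below L p / 10. Summing over
   t < T bounds the mean of |grad f(x^t)|^2 by 4 (f(x^0) - f(xs)) / (eta T), and
   gradient domination turns this into a halving of the expected gap. *)
Require Import Defs.
From mathcomp Require Import ring lra.

Set Implicit Arguments.
Unset Strict Implicit.
Unset Printing Implicit Defensive.

Local Open Scope ring_scope.

(** * Uniform expectation on finite types and expectation over runs *)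

Lemma eq_expect (R : realType) (A : finType) (F G : A -> R) :
  F =1 G -> expect F = expect G.
Proof. by move=> FG; rewrite /expect; under eq_bigr do rewrite FG. Qed.

Lemma expect_le (R : realType) (A : finType) (F G : A -> R) :
  (forall a, F a <= G a) -> expect F <= expect G.
Proof.
by move=> FG; rewrite /expect ler_wpM2l ?invr_ge0 ?ler0n// ler_sum.
Qed.

Lemma expect_ge0 (R : realType) (A : finType) (F : A -> R) :
  (forall a, 0 <= F a) -> 0 <= expect F.
Proof. by move=> F0; rewrite /expect mulr_ge0 ?invr_ge0 ?ler0n// sumr_ge0. Qed.

Lemma expectD (R : realType) (A : finType) (F G : A -> R) :
  expect (fun a => F a + G a) = expect F + expect G.
Proof. by rewrite /expect big_split mulrDr. Qed.

Lemma expectZ (R : realType) (A : finType) (c : R) (F : A -> R) :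
  expect (fun a => c * F a) = c * expect F.
Proof. by rewrite /expect -mulr_sumr mulrCA. Qed.

Lemma expect_cst (R : realType) (A : finType) (c : R) :
  (0 < #|A|)%N -> expect (fun _ : A => c) = c.
Proof.
move=> A0; rewrite /expect sumr_const -[c *+ _]mulr_natl mulKf //.
by rewrite pnatr_eq0 -lt0n.
Qed.

Lemma expect_sum (R : realType) (A : finType) (I : Type) (r : seq I)
    (F : I -> A -> R) :
  expect (fun a => \sum_(i <- r) F i a) = \sum_(i <- r) expect (F i).
Proof. by rewrite /expect exchange_big mulr_sumr. Qed.

Lemma expect_pair (R : realType) (A B : finType) (F : A * B -> R) :
  expect F = expect (fun a => expect (fun b => F (a, b))).
Proof.
rewrite /expect card_prod natrM invfM -mulr_sumr mulrA pair_big /=.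
by congr (_ * _); apply: eq_bigr => -[].
Qed.

Lemma expect_tuple0 (R : realType) (A : finType) (F : 0.-tuple A -> R) :
  expect F = F [tuple].
Proof.
transitivity (expect (fun _ : 0.-tuple A => F [tuple])).
  by apply: eq_expect => t; rewrite (tuple0 t).
by rewrite expect_cst ?card_tuple.
Qed.

(** Independence of the first sample from the later ones, the form used by the inductions on the
    number of steps. *)
Lemma expect_tupleS (R : realType) (A : finType) (n : nat)
    (F : n.+1.-tuple A -> R) :
  expect F = expect (fun a => expect (fun t : n.-tuple A => F [tuple of a :: t])).
Proof.
rewrite -(expect_pair (fun at_ : A * n.-tuple A => F [tuple of at_.1 :: at_.2])) /expect.
rewrite card_prod !card_tuple expnS; congr (_ * _).
apply: (reindex (fun at_ : A * n.-tuple A => [tuple of at_.1 :: at_.2])).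
exists (fun t => (thead t, [tuple of behead t])) => [[a t] _|t _] /=.
  by congr (_, _); apply: val_inj.
by rewrite -tuple_eta.
Qed.

(** Averaging over the samples after the first leaves [q ^+ k * Phi (step s a)], by an induction
    hypothesis that covers every starting state; averaging over [a] then costs one more factor [q].
    Samples beyond the first [k] average out. *)
Lemma expect_foldl_contract (R : realType) (A : finType) (S : Type)
    (step : S -> A -> S) (q : R) (Phi : S -> R) :
  (0 < #|A|)%N -> 0 <= q ->
  (forall s, expect (fun a => Phi (step s a)) <= q * Phi s) ->
  forall K k s, (k <= K)%N ->
    expect (fun w : K.-tuple A => Phi (foldl step s (take k w))) <= q ^+ k * Phi s.
Proof.
move=> A0 q0 contract; elim=> [|K IH] [|k] s // kK.
- by rewrite expect_tuple0 expr0 mul1r.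
- rewrite (@eq_expect _ _ _ (fun=> Phi s)) => [|w]; last by rewrite take0.
  by rewrite expect_cst ?card_tuple ?expn_gt0 ?A0// expr0 mul1r.
rewrite expect_tupleS /=; apply: le_trans (expect_le _) _.
  by move=> a; exact: IH.
by rewrite expectZ exprSr -mulrA ler_wpM2l ?exprn_ge0.
Qed.

(** Telescoping: each step pays for its [q] out of the expected drop of [P], and at most [P s - m]
    can be spent. The drop is only required on states satisfying [inv], which the run preserves. *)
Lemma expect_foldl_lyapunov (R : realType) (A : finType) (S : Type)
    (step : S -> A -> S) (inv : S -> Prop) (P q : S -> R) (m : R) :
  (0 < #|A|)%N ->
  (forall s a, inv s -> inv (step s a)) ->
  (forall s, m <= P s) ->
  (forall s, inv s -> expect (fun a => P (step s a)) <= P s - q s) ->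
  forall T s, inv s ->
    \sum_(t < T) expect (fun w : T.-tuple A => q (foldl step s (take t w)))
    <= P s - m.
Proof.
move=> A0 inv_step mP decr; elim=> [|T IH] s inv_s.
  by rewrite big_ord0 subr_ge0.
rewrite big_ord_recl (@eq_expect _ _ _ (fun=> q s)) => [|w]; last by rewrite take0.
rewrite expect_cst ?card_tuple ?expn_gt0 ?A0//.
(* Since [bump 0 i] is [i + 1], the first sample moves [s] to [step s a] and the other [i] come from
   the tail. *)
have -> : \sum_(i < T) expect (fun w : T.+1.-tuple A =>
      q (foldl step s (take (bump 0 i) w))) =
    expect (fun a => \sum_(i < T) expect (fun w : T.-tuple A =>
      q (foldl step (step s a) (take i w)))).
  by rewrite expect_sum; apply: eq_bigr => i _; rewrite expect_tupleS.
have le1 : expect (fun a => \sum_(i < T) expect (fun w : T.-tuple A =>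
      q (foldl step (step s a) (take i w)))) <=
    expect (fun a => P (step s a) + - m).
  by apply: expect_le => a; apply: IH; exact: inv_step.
move: (decr s inv_s) le1; rewrite expectD expect_cst//; lra.
Qed.

(** * Euclidean inner product and the descent inequality *)

Definition dot (R : realType) (d : nat) (u v : 'rV[R]_d) : R :=
  \sum_(j < d) u 0 j * v 0 j.

Lemma dotC (R : realType) (d : nat) (u v : 'rV[R]_d) : dot u v = dot v u.
Proof. by apply: eq_bigr => j _; rewrite mulrC. Qed.

Lemma dotDl (R : realType) (d : nat) (u v w : 'rV[R]_d) :
  dot (u + v) w = dot u w + dot v w.
Proof. by rewrite /dot -big_split; apply: eq_bigr => j _; rewrite mxE mulrDl. Qed.

Lemma dotDr (R : realType) (d : nat) (u v w : 'rV[R]_d) :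
  dot w (u + v) = dot w u + dot w v.
Proof. by rewrite dotC dotDl !(dotC w). Qed.

Lemma dotZl (R : realType) (d : nat) (c : R) (u v : 'rV[R]_d) :
  dot (c *: u) v = c * dot u v.
Proof. by rewrite /dot mulr_sumr; apply: eq_bigr => j _; rewrite mxE mulrA. Qed.

Lemma dotZr (R : realType) (d : nat) (c : R) (u v : 'rV[R]_d) :
  dot u (c *: v) = c * dot u v.
Proof. by rewrite dotC dotZl dotC. Qed.

Lemma dotNl (R : realType) (d : nat) (u v : 'rV[R]_d) : dot (- u) v = - dot u v.
Proof. by rewrite -scaleN1r dotZl mulN1r. Qed.

Lemma dotNr (R : realType) (d : nat) (u v : 'rV[R]_d) : dot u (- v) = - dot u v.
Proof. by rewrite dotC dotNl dotC. Qed.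

Lemma dot_sumr (R : realType) (d : nat) (I : Type) (r : seq I)
    (u : 'rV[R]_d) (F : I -> 'rV[R]_d) :
  dot u (\sum_(i <- r) F i) = \sum_(i <- r) dot u (F i).
Proof.
rewrite /dot exchange_big; apply: eq_bigr => j _.
by rewrite summxE mulr_sumr.
Qed.

Lemma dot_ge0 (R : realType) (d : nat) (u : 'rV[R]_d) : 0 <= dot u u.
Proof. by apply: sumr_ge0 => j _; rewrite -expr2 sqr_ge0. Qed.

Lemma norm2_ge0 (R : realType) (d : nat) (u : 'rV[R]_d) : 0 <= norm2 u.
Proof. exact: sqrtr_ge0. Qed.

Lemma sqr_norm2 (R : realType) (d : nat) (u : 'rV[R]_d) :
  norm2 u ^+ 2 = dot u u.
Proof.
rewrite /norm2 sqr_sqrtr; last by apply: sumr_ge0 => j _; rewrite sqr_ge0.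
by apply: eq_bigr => j _; rewrite expr2.
Qed.

(** Expand [|b u - v|^2 >= 0] and divide by [b]. *)
Lemma young_dot (R : realType) (d : nat) (b : R) (u v : 'rV[R]_d) :
  0 < b -> 2 * dot u v <= b * dot u u + b^-1 * dot v v.
Proof.
move=> b0; have := dot_ge0 (b *: u - v).
rewrite !(dotDl, dotDr, dotNl, dotNr, dotZl, dotZr) (dotC v u) => h.
rewrite -(ler_pM2l b0) mulrDr (mulrA b b^-1) mulfV ?gt_eqF// mul1r.
by lra.
Qed.

Lemma smooth_dot (R : realType) (d : nat) (L : R) (h : 'rV[R]_d -> R) x y :
  0 <= L -> smooth L h ->
  dot (grad h x - grad h y) (grad h x - grad h y) <= L ^+ 2 * dot (x - y) (x - y).
Proof.
move=> L0 [_ /(_ x y) hL]; rewrite -!sqr_norm2 -exprMn.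
by rewrite ler_sqr ?nnegrE ?mulr_ge0 ?norm2_ge0.
Qed.

Lemma derive_dot_grad (R : realType) (d : nat) (h : 'rV[R]_d -> R) (x u : 'rV[R]_d) :
  differentiable h x -> 'D_u h x = dot (grad h x) u.
Proof.
move=> dh; rewrite deriveE// [in LHS](row_sum_delta u) linear_sum.
by apply: eq_bigr => j _; rewrite linearZ mxE deriveE// mulrC.
Qed.

Lemma is_derive_line (R : realType) (d : nat) (h : 'rV[R]_d -> R)
    (x u : 'rV[R]_d) (t : R) :
  (forall y, differentiable h y) ->
  is_derive t 1 (fun s : R => h (x + s *: u)) (dot (grad h (x + t *: u)) u).
Proof.
move=> dh.
have E : (fun k : R => k^-1 *: (((fun s => h (x + s *: u)) \o shift t) (k *: 1)
      - h (x + t *: u))) =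
    (fun k : R => k^-1 *: ((h \o shift (x + t *: u)) (k *: u) - h (x + t *: u))).
  apply/funext => k /=; congr (_ *: (h _ - _)).
  by rewrite [k *: 1]mulr1 scalerDl addrCA.
split; first by rewrite /derivable E; exact: diff_derivable.
by rewrite -derive_dot_grad// /derive E.
Qed.

(** Along the segment, [phi] is [h] minus the linear and quadratic terms of the bound. Its
    derivative is nonpositive on the open unit interval, so [phi 1 <= phi 0], which is the claim. *)
Lemma smooth_descent (R : realType) (d : nat) (L : R) (h : 'rV[R]_d -> R)
    (x u : 'rV[R]_d) :
  0 < L -> smooth L h ->
  h (x + u) <= h x + dot (grad h x) u + L / 2 * dot u u.
Proof.
move=> L0 hs; have dh := hs.1.
pose phi (t : R) :=
  h (x + t *: u) + (- (dot (grad h x) u * t) - L / 2 * dot u u * t ^+ 2).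
pose dphi (t : R) :=
  dot (grad h (x + t *: u)) u - dot (grad h x) u - L * dot u u * t.
have phiD t : is_derive t (1 : R) phi (dphi t).
  have := is_derive_line x u t dh => line.
  rewrite /phi; apply: is_derive_eq; rewrite /dphi /GRing.scale /=.
  by field.
have : phi 1 <= phi 0.
  apply: (@ler0_derive1_le_cc _ phi 0 1) => //; rewrite ?in_itv /= ?lexx ?ler01 //.
    move=> t; rewrite in_itv /= => /andP[t0 t1].
    rewrite derive1E derive_val /dphi.
    have Lt : 0 < L * t by rewrite mulr_gt0.
    (* With weight [1 / (L t)], both halves of Young's bound are at most [L t |u|^2], which matches
       the quadratic term of [dphi] exactly. *)
    have := @young_dot _ _ (L * t)^-1 (grad h (x + t *: u) - grad h x) u.
    rewrite invr_gt0 invrK => /(_ Lt).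
    have := smooth_dot (x + t *: u) x (ltW L0) hs.
    have -> : x + t *: u - x = t *: u by rewrite addrAC subrr add0r.
    rewrite dotZl dotZr => sm yg.
    have {}yg : 2 * dot (grad h (x + t *: u) - grad h x) u <=
        (L * t)^-1 * (L ^+ 2 * (t * (t * dot u u))) + L * t * dot u u.
      apply: le_trans yg _; rewrite lerD2r.
      by rewrite ler_wpM2l ?invr_ge0 ?(ltW Lt).
    have E : (L * t)^-1 * (L ^+ 2 * (t * (t * dot u u))) = L * t * dot u u.
      by field; rewrite !gt_eqF.
    move: yg; rewrite E dotDl dotNl; lra.
  by apply: derivable_within_continuous => t _.
rewrite /phi scale1r scale0r addr0; lra.
Qed.

(** * Averages over the components: gradient, descent and variance *)

(** Vector counterpart of [expect], which is real-valued. *)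
Definition mean (R : realType) (d n : nat) (F : 'I_n -> 'rV[R]_d) : 'rV[R]_d :=
  n%:R^-1 *: \sum_(i < n) F i.

Lemma exchange_expect (R : realType) (A B : finType) (F : A -> B -> R) :
  expect (fun a => expect (F a)) = expect (fun b => expect (fun a => F a b)).
Proof. by rewrite /expect -!mulr_sumr mulrCA exchange_big. Qed.

Lemma finite_sumE (R : realType) (d n : nat) (fs : 'I_n -> 'rV[R]_d -> R) x :
  finite_sum fs x = expect (fun i => fs i x).
Proof. by rewrite /expect card_ord. Qed.

Lemma dot_meanr (R : realType) (d n : nat) (u : 'rV[R]_d) (F : 'I_n -> 'rV[R]_d) :
  dot u (mean F) = expect (fun i => dot u (F i)).
Proof. by rewrite dotZr dot_sumr /expect card_ord. Qed.

Lemma meanB (R : realType) (d n : nat) (F G : 'I_n -> 'rV[R]_d) :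
  mean (fun i => F i - G i) = mean F - mean G.
Proof. by rewrite /mean sumrB scalerBr. Qed.

Lemma grad_finite_sum (R : realType) (d n : nat) (fs : 'I_n -> 'rV[R]_d -> R) x :
  (forall i, differentiable (fs i) x) ->
  grad (finite_sum fs) x = mean (fun i => grad (fs i) x).
Proof.
move=> dfs; have -> : finite_sum fs = n%:R^-1 \*: \sum_(i < n) fs i.
  by apply/funext => y; rewrite /finite_sum /= fct_sumE.
have dfsv v i : derivable (fs i) x v by exact: diff_derivable.
apply/rowP => j; rewrite mxE deriveZ; last exact: derivable_sum.
rewrite derive_sum// /mean !mxE summxE; congr (_ * _).
by apply: eq_bigr => i _; rewrite mxE.
Qed.

(** Averages the descent inequalities of the components. *)
Lemma finite_sum_descent (R : realType) (d n : nat) (L : R)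
    (fs : 'I_n -> 'rV[R]_d -> R) (x u : 'rV[R]_d) :
  (0 < n)%N -> 0 < L -> (forall i, smooth L (fs i)) ->
  finite_sum fs (x + u) <=
    finite_sum fs x + dot (grad (finite_sum fs) x) u + L / 2 * dot u u.
Proof.
move=> n0 L0 sm; rewrite grad_finite_sum; last by move=> i; case: (sm i).
rewrite dotC dot_meanr !finite_sumE.
have -> : L / 2 * dot u u = expect (fun _ : 'I_n => L / 2 * dot u u).
  by rewrite expect_cst ?card_ord.
rewrite -!expectD; apply: expect_le => i; rewrite (dotC u); exact: smooth_descent.
Qed.

Lemma expect_dot_recentre (R : realType) (d n : nat) (F : 'I_n -> 'rV[R]_d)
    (u w : 'rV[R]_d) : (0 < n)%N ->
  expect (fun i => dot u (F i - mean F + w)) = dot u w.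
Proof.
move=> n0; under eq_expect do rewrite !dotDr dotNr.
by rewrite !expectD !expect_cst ?card_ord// -dot_meanr subrr add0r.
Qed.

(** The left side equals [|w|^2] plus the variance of [F], and a variance is at most the second
    moment: the discarded term is [|m|^2]. *)
Lemma expect_sqr_recentre (R : realType) (d n : nat) (F : 'I_n -> 'rV[R]_d)
    (w : 'rV[R]_d) : (0 < n)%N ->
  expect (fun i => dot (F i - mean F + w) (F i - mean F + w)) <=
    dot w w + expect (fun i => dot (F i) (F i)).
Proof.
move=> n0; set m := mean F.
(* The only part of the vector [F i - m + w] left besides [|F i|^2] is linear, so
   [expect_dot_recentre] evaluates it. *)
have E i : dot (F i - m + w) (F i - m + w) =
    dot (F i) (F i) + - dot m m + 2 * dot (w - m) (F i - m + w)
      + (2 * dot m w - dot w w).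
  by rewrite !(dotDl, dotDr, dotNl, dotNr) !(dotC (F i)) (dotC w m); ring.
under eq_expect do rewrite E.
rewrite !expectD expectZ expect_dot_recentre// !expect_cst ?card_ord//.
have := dot_ge0 m; rewrite dotDl dotNl; lra.
Qed.

Lemma expect_if_eq (R : realType) (n : nat) (l : 'I_n) (a b : R) : (0 < n)%N ->
  expect (fun j => if l == j then a else b) = b + n%:R^-1 * (a - b).
Proof.
move=> n0.
have E j : (if l == j then a else b) = b + (if l == j then a - b else 0).
  by case: ifP; rewrite ?addr0 // addrC subrK.
under eq_expect do rewrite E.
rewrite expectD expect_cst ?card_ord// /expect card_ord; congr (_ + _ * _).
by rewrite -big_mkcond (big_pred1 l) // => j; rewrite /= eq_sym.
Qed.

(** * One SAGA step and its potential *)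

(** This makes the search direction unbiased: averaged over [i], the stored gradients cancel against
    [saga_g]. *)
Definition saga_inv (R : realType) (d n : nat) (fs : 'I_n -> 'rV[R]_d -> R)
    (s : saga_state R d n) : Prop :=
  saga_g s = mean (fun i => grad (fs i) (saga_alpha s i)).

Lemma saga_inv_init (R : realType) (d n : nat) (fs : 'I_n -> 'rV[R]_d -> R) x0 :
  saga_inv fs (saga_init fs x0).
Proof. by []. Qed.

Lemma saga_inv_step (R : realType) (d n : nat) (fs : 'I_n -> 'rV[R]_d -> R)
    (eta : R) (s : saga_state R d n) (ij : 'I_n * 'I_n) :
  saga_inv fs s -> saga_inv fs (saga_step fs eta s ij).
Proof.
case: s ij => x al g [i j]; rewrite /saga_inv /= => ->.
rewrite /mean -scalerBr; congr (_ *: _).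
rewrite (bigD1 j) //= [in RHS](bigD1 j) //= eqxx opprB [LHS]addrC addrA subrK.
congr (_ + _).
by apply: eq_bigr => l /negbTE ->.
Qed.

Definition saga_dist (R : realType) (d n : nat) (s : saga_state R d n) : R :=
  expect (fun l => dot (saga_x s - saga_alpha s l) (saga_x s - saga_alpha s l)).

Definition saga_dir (R : realType) (d n : nat) (fs : 'I_n -> 'rV[R]_d -> R)
    (s : saga_state R d n) (i : 'I_n) : 'rV[R]_d :=
  grad (fs i) (saga_x s) - grad (fs i) (saga_alpha s i) + saga_g s.

(** For each [l], the point [alpha_l] becomes the old [x] with probability [1/n], at distance
    [eta |v|] from the new iterate; otherwise it stays and the square is expanded. The cross term is
    kept exact, so that averaging over [i] later replaces [v] by the full gradient. *)
Lemma expect_saga_dist_step (R : realType) (d n : nat)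
    (fs : 'I_n -> 'rV[R]_d -> R) (eta : R) (s : saga_state R d n) (i : 'I_n) :
  (0 < n)%N ->
  let v := saga_dir fs s i in
  let z := mean (fun l => saga_x s - saga_alpha s l) in
  expect (fun j => saga_dist (saga_step fs eta s (i, j))) =
    eta ^+ 2 * dot v v +
    (1 - n%:R^-1) * (saga_dist s - 2 * eta * dot z v).
Proof.
case: s => x al g n0 v z; rewrite /saga_dist /= -/v.
rewrite exchange_expect.
set y := x - eta *: v.
have E l : expect (fun j => dot (y - (if l == j then x else al l))
      (y - (if l == j then x else al l))) =
    eta ^+ 2 * dot v v + (1 - n%:R^-1) *
      (dot (x - al l) (x - al l) + - (2 * eta) * dot v (x - al l)).
  have yx : y - x = - eta *: v by rewrite /y addrAC subrr add0r scaleNr.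
  have yal : y - al l = (x - al l) - eta *: v by rewrite /y addrAC.
  rewrite (@eq_expect _ _ _ (fun j => if l == j then dot (y - x) (y - x)
    else dot (y - al l) (y - al l))) => [|j]; last by case: ifP.
  rewrite expect_if_eq// yx yal; move: (x - al l) => w; clearbody v.
  rewrite !(dotDl, dotDr, dotNl, dotNr, dotZl, dotZr) (dotC w v); ring.
under eq_expect do rewrite E.
rewrite expectD expect_cst ?card_ord// expectZ expectD expectZ.
by rewrite (dotC z) dot_meanr; ring.
Qed.

(* [G], [A], [V], [D] stand for |grad f(x)|^2, the mean of |x - alpha_l|^2, the
   second moment of the search direction, and the mean of
   <x - alpha_l, grad f(x)>. *)
Lemma lyapunov_coefficients (R : realType) (L p G A V D : R) :
  0 < L -> 0 < p -> p <= 1 -> 0 <= G -> 0 <= A ->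
  V <= G + L ^+ 2 * A -> - (2 * D) <= (L * p)^-1 * G + L * p * A ->
  forall eta, eta = p ^+ 2 / (3 * L) ->
  - eta * G + L / 2 * eta ^+ 2 * V +
    L * p / 10 * (eta ^+ 2 * V + (1 - p ^+ 3) * (A - 2 * eta * D)) <=
  L * p / 10 * A - eta / 4 * G.
Proof.
move=> L0 p0 p1 G0 A0 hV hD eta etaE.
have eta0 : 0 < eta by rewrite etaE divr_gt0 ?exprn_gt0 ?mulr_gt0 ?ltr0n.
have c0 : 0 < L * p / 10 by rewrite divr_gt0 ?mulr_gt0 ?ltr0n.
have p3 : 0 <= 1 - p ^+ 3 by rewrite subr_ge0 exprn_ile1 ?(ltW p0).
have hV' : (L / 2 * eta ^+ 2 + L * p / 10 * eta ^+ 2) * V <=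
    (L / 2 * eta ^+ 2 + L * p / 10 * eta ^+ 2) * (G + L ^+ 2 * A).
  rewrite ler_wpM2l// -mulrDl mulr_ge0 ?exprn_ge0 ?(ltW eta0)//.
  by rewrite addr_ge0 ?(ltW c0)// divr_ge0 ?(ltW L0).
have hD' : L * p / 10 * (1 - p ^+ 3) * eta * - (2 * D) <=
    L * p / 10 * (1 - p ^+ 3) * eta * ((L * p)^-1 * G + L * p * A).
  by rewrite ler_wpM2l// (mulr_ge0 (mulr_ge0 (ltW c0) p3) (ltW eta0)).
(* With [eta = p^2 / (3 L)], the bracket is three quarters of the descent term, minus the two
   second-moment terms and the Young term. *)
have hG : 0 <= G * p ^+ 2 / L *
    (1 / 4 - p ^+ 2 / 18 - p ^+ 3 / 90 - (1 - p ^+ 3) / 30).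
  rewrite mulr_ge0 ?divr_ge0 ?mulr_ge0 ?exprn_ge0 ?(ltW p0) ?(ltW L0)//.
  have : p ^+ 2 <= 1 by rewrite exprn_ile1 ?(ltW p0).
  have : 0 <= p ^+ 3 by rewrite exprn_ge0 ?(ltW p0).
  lra.
(* The contraction gives [1/10] and Young's bound takes [(1 - p^3) / 30], leaving [1/15 + p^3 / 30].
   Since [1/15 = 1/18 + 1/90] and [p <= 1], the weight [L p / 10] just suffices. *)
have hA : 0 <= A * L * p ^+ 4 * (1 / 15 + p ^+ 3 / 30 - 1 / 18 - p / 90).
  rewrite mulr_ge0 ?mulr_ge0 ?exprn_ge0 ?(ltW p0) ?(ltW L0)//.
  have : 0 <= p ^+ 3 by rewrite exprn_ge0 ?(ltW p0).
  lra.
rewrite -subr_ge0.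
(* The gap is a sum of four nonnegative terms: [hG], [hA], and the slacks in [hV'] and [hD']. *)
have E : L * p / 10 * A - eta / 4 * G - (- eta * G + L / 2 * eta ^+ 2 * V +
    L * p / 10 * (eta ^+ 2 * V + (1 - p ^+ 3) * (A - 2 * eta * D))) =
  G * p ^+ 2 / L * (1 / 4 - p ^+ 2 / 18 - p ^+ 3 / 90 - (1 - p ^+ 3) / 30) +
  A * L * p ^+ 4 * (1 / 15 + p ^+ 3 / 30 - 1 / 18 - p / 90) +
  ((L / 2 * eta ^+ 2 + L * p / 10 * eta ^+ 2) * (G + L ^+ 2 * A) -
  (L / 2 * eta ^+ 2 + L * p / 10 * eta ^+ 2) * V) +
  (L * p / 10 * (1 - p ^+ 3) * eta * ((L * p)^-1 * G + L * p * A) -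
  L * p / 10 * (1 - p ^+ 3) * eta * - (2 * D)).
  by rewrite etaE; field; rewrite !gt_eqF.
by rewrite E; apply: (addr_ge0 (addr_ge0 (addr_ge0 hG hA) _)); rewrite subr_ge0.
Qed.

Definition saga_lyapunov (R : realType) (d n : nat) (c : R)
    (fs : 'I_n -> 'rV[R]_d -> R) (s : saga_state R d n) : R :=
  finite_sum fs (saga_x s) + c * saga_dist s.

(** Averaging over [j] at fixed [i] leaves a bound that depends on the direction only through linear
    terms and its square. Averaging over [i] thus needs just its mean, the full gradient, and its
    second moment. *)
Lemma saga_lyapunov_decrease (R : realType) (d n : nat) (L p eta : R)
    (fs : 'I_n -> 'rV[R]_d -> R) (s : saga_state R d n) :
  (0 < n)%N -> 0 < L -> (forall i, smooth L (fs i)) ->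
  0 < p -> p ^+ 3 = n%:R^-1 -> saga_inv fs s ->
  eta = p ^+ 2 / (3 * L) ->
  expect (fun ij => saga_lyapunov (L * p / 10) fs (saga_step fs eta s ij)) <=
  saga_lyapunov (L * p / 10) fs s -
  eta / 4 * dot (grad (finite_sum fs) (saga_x s)) (grad (finite_sum fs) (saga_x s)).
Proof.
move=> n0 L0 sm p0 p3 inv_s etaE; set x := saga_x s; set df := grad _ x.
have p1 : p <= 1.
  have : p ^+ 3 <= 1 by rewrite p3 invf_le1 ?ltr0n// ler1n.
  by rewrite expr_le1// ltW.
pose xi i := grad (fs i) x - grad (fs i) (saga_alpha s i).
have dfE : df = mean (fun i => grad (fs i) x).
  by rewrite /df grad_finite_sum// => i; case: (sm i).
have dirE i : saga_dir fs s i = xi i - mean xi + df.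
  by rewrite /saga_dir inv_s meanB -dfE opprB addrA subrK.
pose z := mean (fun l => x - saga_alpha s l).
pose V := expect (fun i => dot (saga_dir fs s i) (saga_dir fs s i)).
have step_i i : expect (fun j =>
    saga_lyapunov (L * p / 10) fs (saga_step fs eta s (i, j))) <=
    finite_sum fs x + L * p / 10 * (1 - p ^+ 3) * saga_dist s +
    - eta * dot df (saga_dir fs s i) +
    (L / 2 * eta ^+ 2 + L * p / 10 * eta ^+ 2) *
      dot (saga_dir fs s i) (saga_dir fs s i) +
    - (2 * eta * (L * p / 10) * (1 - p ^+ 3)) * dot z (saga_dir fs s i).
  rewrite /saga_lyapunov expectD expectZ expect_saga_dist_step// -p3 -/x -/z.
  (* The new iterate depends on [i] alone; [j] affects only the table and [saga_g]. *)
  rewrite (@eq_expect _ _ _ (fun=> finite_sum fs (x - eta *: saga_dir fs s i)));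
    last by move=> j; rewrite /x /saga_dir; case: (s).
  rewrite expect_cst ?card_ord//.
  have := finite_sum_descent x (- (eta *: saga_dir fs s i)) n0 L0 sm.
  rewrite -/df !(dotNl, dotNr, dotZl, dotZr); lra.
rewrite expect_pair; apply: le_trans (expect_le step_i) _.
have affineE (a b c e : R) (F G H : 'I_n -> R) :
    expect (fun i => a + b * F i + c * G i + e * H i) =
    a + b * expect F + c * expect G + e * expect H.
  by rewrite !expectD !expectZ expect_cst ?card_ord.
rewrite affineE -/V.
have meanE u : expect (fun i => dot u (saga_dir fs s i)) = dot u df.
  by under eq_expect do rewrite dirE; rewrite expect_dot_recentre.
rewrite !meanE.
have hV : V <= dot df df + L ^+ 2 * saga_dist s.
  rewrite /V; under eq_expect do rewrite dirE.
  apply: le_trans (expect_sqr_recentre _ _ n0) _; rewrite lerD2l -expectZ.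
  by apply: expect_le => i; apply: smooth_dot => //; exact: ltW.
have hD : - (2 * dot z df) <= (L * p)^-1 * dot df df + L * p * saga_dist s.
  have cstE : expect (fun _ : 'I_n => (L * p)^-1 * dot df df) =
      (L * p)^-1 * dot df df.
    by rewrite expect_cst ?card_ord.
  rewrite dotC dot_meanr -mulNr -cstE -!expectZ.
  rewrite -expectD; apply: expect_le => l.
  have Lp0 : 0 < (L * p)^-1 by rewrite invr_gt0 mulr_gt0.
  (* The weight [1 / (L p)] cancels the factor [L p] of the potential in front of the squared
     gradient. *)
  have := young_dot (- df) (x - saga_alpha s l) Lp0.
  by rewrite invrK !(dotNl, dotNr) opprK mulrN mulNr.
have A0 : 0 <= saga_dist s by apply: expect_ge0 => l; exact: dot_ge0.
have := lyapunov_coefficients L0 p0 p1 (dot_ge0 df) A0 hV hD etaE.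
rewrite /saga_lyapunov -/x; lra.
Qed.

(** * From one SAGA call to GD-SAGA *)

Lemma expect_saga_contract (R : realType) (d n T : nat)
    (fs : 'I_n -> 'rV[R]_d -> R) (L tau p eta : R) (x0 xs : 'rV[R]_d) :
  (0 < n)%N -> 0 < L -> 0 < tau -> (forall i, smooth L (fs i)) ->
  global_minimizer (finite_sum fs) xs ->
  gradient_dominated tau (finite_sum fs) xs ->
  0 < p -> p ^+ 3 = n%:R^-1 -> eta = p ^+ 2 / (3 * L) ->
  (0 < T)%N -> 24 * L * tau <= T%:R * p ^+ 2 ->
  expect (fun w : saga_sample n T =>
    finite_sum fs (saga fs eta x0 w) - finite_sum fs xs)
  <= 2^-1 * (finite_sum fs x0 - finite_sum fs xs).
Proof.
move=> n0 L0 tau0 sm xs_min f_dom p0 p3 etaE T0 hT.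
pose f := finite_sum fs; rewrite -/f.
have eta0 : 0 < eta by rewrite etaE divr_gt0 ?exprn_gt0 ?mulr_gt0 ?ltr0n.
have pairs0 : (0 < #|{: 'I_n * 'I_n}|)%N by rewrite card_prod card_ord muln_gt0 n0.
have lyap_ge s : f xs <= saga_lyapunov (L * p / 10) fs s.
  have c0 : 0 <= L * p / 10 by rewrite divr_ge0 ?mulr_ge0 ?(ltW L0) ?(ltW p0).
  rewrite -[leLHS]addr0; apply: lerD (xs_min _) (mulr_ge0 c0 _).
  by apply: expect_ge0 => l; exact: dot_ge0.
have sumN := expect_foldl_lyapunov pairs0 (@saga_inv_step _ _ _ fs eta) lyap_ge
  (fun s inv_s => saga_lyapunov_decrease n0 L0 sm p0 p3 inv_s etaE) T
  (saga_inv_init fs x0).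
rewrite -/f /saga_lyapunov /= in sumN.
(* Every [alpha_l] starts at [x0], so the initial potential is just [f x0]. *)
have dist0 : saga_dist (saga_init fs x0) = 0.
  rewrite /saga_dist /= subrr expect_cst ?card_ord// /dot.
  by rewrite big1 // => j _; rewrite mxE mul0r.
rewrite dist0 mulr0 addr0 in sumN.
(* The factor [4 tau / eta] turns the guaranteed decrease [(eta / 4) |grad f|^2] into the
   gradient-domination bound [tau |grad f|^2]. *)
have C0 : 0 < 4 * tau / eta by rewrite divr_gt0 ?mulr_gt0 ?ltr0n.
(* The uniform output index turns the expected gap into [1/T] times a sum over the iterates. *)
rewrite expect_pair exchange_expect {1}/expect card_ord.
apply: (@le_trans _ _ (T%:R^-1 * (4 * tau / eta * (f x0 - f xs)))); last first.
  (* Here [4 tau / (eta T) = 12 L tau / (T p^2)], at most [1/2] by [hT]. *)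
  rewrite mulrA ler_wpM2r ?subr_ge0// ler_pdivrMl ?ltr0n// etaE.
  rewrite invf_div mulrA ler_pdivrMr ?exprn_gt0//; lra.
rewrite ler_wpM2l ?invr_ge0 ?ler0n//.
apply: le_trans (ler_wpM2l (ltW C0) sumN); rewrite mulr_sumr ler_sum// => t _.
rewrite -expectZ; apply: expect_le => w.
apply: le_trans (f_dom _) _; rewrite sqr_norm2 -/f.
rewrite mulrA; have -> : 4 * tau / eta * (eta / 4) = tau by field; rewrite gt_eqF.
by [].
Qed.

Theorem theorem6 (R : realType) (d n : nat) (fs : 'I_n -> 'rV[R]_d -> R)
    (L tau eta : R) (T K : nat) (x0 xs : 'rV[R]_d)
    (n_gt0 : (0 < n)%N) (L_gt0 : 0 < L) (tau_gt0 : 0 < tau)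
    (fs_smooth : forall i : 'I_n, smooth L (fs i))
    (xs_min : global_minimizer (finite_sum fs) xs)
    (f_dom : gradient_dominated tau (finite_sum fs) xs)
    (eta_def : eta = 1 / (3 * L * n%:R `^ (2 / 3)))
    (T_def : T%:Z = Num.ceil (24 * L * tau * n%:R `^ (2 / 3)))
    (k : nat) (k_le_K : (k <= K)%N) :
  expect (fun w : gd_saga_sample n T K =>
    finite_sum fs (gd_saga fs eta x0 w k) - finite_sum fs xs)
  <= 2 ^- k * (finite_sum fs x0 - finite_sum fs xs).
Proof.
(* The cube root of [n]; its inverse is the [p] of the one-call analysis. *)
pose r : R := n%:R `^ (1 / 3).
have r0 : 0 < r by rewrite powR_gt0 ?ltr0n.
have r3 : r ^+ 3 = n%:R.
  rewrite -powR_mulrn ?ltW// -powRrM -mulrA mul1r.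
  by rewrite mulVf ?pnatr_eq0// powRr1 ?ler0n.
have r2 : n%:R `^ (2 / 3) = r ^+ 2.
  by rewrite -powR_mulrn ?ltW// -powRrM; congr (_ `^ _); field.
rewrite r2 in eta_def T_def.
have T_ge : 24 * L * tau * r ^+ 2 <= T%:R.
  by rewrite -[T%:R]/(T%:Z%:~R) T_def ceil_ge.
(* Positivity of [T] makes the sample space of a call nonempty, so that [expect] is a genuine
   average. *)
have T0 : (0 < T)%N.
  rewrite -(ltr0n R); apply: lt_le_trans T_ge.
  by rewrite !mulr_gt0 ?ltr0n.
have contract x := @expect_saga_contract R d n T fs L tau r^-1 eta x xs n_gt0 L_gt0
  tau_gt0 fs_smooth xs_min f_dom.
rewrite -exprVn.
apply: (@expect_foldl_contract _ _ _ (saga fs eta) 2^-1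
  (fun x => finite_sum fs x - finite_sum fs xs)) => //.
- rewrite card_prod card_tuple card_prod !card_ord.
  by rewrite muln_gt0 expn_gt0 muln_gt0 n_gt0 T0.
- move=> x; apply: contract => //.
  + by rewrite invr_gt0.
  + by rewrite exprVn r3.
  + by rewrite eta_def; field; rewrite !gt_eqF.
  + by rewrite exprVn ler_pdivlMr ?exprn_gt0.
Qed.
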